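(* Let $A$ be an algebra over a commutative ring $k$, with center $Z(A)$. There exists a unitary $k$-linear map $E: A\to Z(A)$ (that is, a $k$-linear map with $E(1_A)=1_A$) in each of the following situations: (1) $A$ is commutative; (2) $k$ is a field; (3) $A$ is an augmented algebra, for example a bialgebra; (4) $A$ is a separable $k$-algebra.
   Context: Algebras are associative and unital. An augmented $k$-algebra is a $k$-algebra $A$ equipped with a $k$-algebra homomorphism $\varepsilon: A\to k$. A $k$-algebra $A$ is separable if there exists a separability idempotent $e=e^1\otimes e^2\in A\otimes_k A$ (summation understood) such that $ae^1\otimes e^2=e^1\otimes e^2a$ for all $a\in A$ and $e^1e^2=1_A$. *)

(* Defs.v *)
From HB Require Import structures.
From mathcomp Require Import all_boot all_algebra.
From mathcomp Require Import boolp.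

Set Implicit Arguments.
Unset Strict Implicit.
Unset Printing Implicit Defensive.

Import GRing.Theory.
Local Open Scope ring_scope.
Local Open Scope quotient_scope.

(** [algType] forces [1 != 0], hence excludes the zero algebra; [pzAlgType] does
    not.  The scaling is a field of the mixin, rather than inherited from
    [lmodType], because MathComp has no common ancestor for a ring and a module
    structure below [lSemiAlgType]; the module structure is derived from it. *)
HB.mixin Record isPzAlgebra (k : pzRingType) A of GRing.PzRing A := {
  pzscale : k -> A -> A;
  pzscalerA : forall a b x, pzscale a (pzscale b x) = pzscale (a * b) x;
  pzscale1r : left_id 1 pzscale;
  pzscalerDr : right_distributive pzscale +%R;
  pzscalerDl : forall x, {morph pzscale^~ x : a b / a + b};
  pzscalerAl : forall a x y, pzscale a (x * y) = pzscale a x * y;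
  pzscalerAr : forall a x y, pzscale a (x * y) = x * pzscale a y
}.

#[short(type="pzAlgType")]
HB.structure Definition PzAlgebra (k : pzRingType) :=
  {A of GRing.PzRing A & isPzAlgebra k A}.

#[non_forgetful_inheritance]
HB.instance Definition _ (k : pzRingType) (A : pzAlgType k) :=
  GRing.Zmodule_isLmodule.Build k A
    (@pzscalerA k A) (@pzscale1r k A) (@pzscalerDr k A) (@pzscalerDl k A).

Section PzAlgebraTheory.
Variables (k : pzRingType) (A : pzAlgType k).

Lemma pzalg_scalerAl (a : k) (x y : A) : a *: (x * y) = (a *: x) * y.
Proof. exact: pzscalerAl. Qed.

Lemma pzalg_scalerAr (a : k) (x y : A) : a *: (x * y) = x * (a *: y).
Proof. exact: pzscalerAr. Qed.

End PzAlgebraTheory.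

HB.instance Definition _ (k : pzRingType) (A : algType k) :=
  isPzAlgebra.Build k A (@scalerA k A) (@scale1r k A) (@scalerDr k A)
    (@scalerDl k A) (@scalerAl k A) (@scalerAr k A).

HB.instance Definition _ (k : comPzRingType) :=
  isPzAlgebra.Build k k^o (@mulrA k) (@mul1r k) (@mulrDr k)
    (fun x a b => mulrDl a b x) (@mulrA k) (@mulrCA k).

Section Center.
Variables (k : pzRingType) (A : pzAlgType k).

Definition in_center : {pred A} := fun x => `[< forall y, x * y = y * x >].

Lemma in_centerP x : reflect (forall y, x * y = y * x) (x \in in_center).
Proof. exact: asboolP. Qed.

Fact in_center_subring : subring_closed in_center.
Proof.
split=> [|x y /in_centerP cx /in_centerP cy|x y /in_centerP cx /in_centerP cy].
- by apply/in_centerP => y; rewrite mul1r mulr1.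
- by apply/in_centerP => z; rewrite mulrBl mulrBr cx cy.
- by apply/in_centerP => z; rewrite -mulrA cy mulrA cx mulrA.
Qed.
HB.instance Definition _ :=
  GRing.isSubringClosed.Build A in_center in_center_subring.

Fact in_center_scale : GRing.scaler_closed in_center.
Proof.
by move=> a x /in_centerP cx; apply/in_centerP => y;
   rewrite -pzalg_scalerAl -pzalg_scalerAr cx.
Qed.
HB.instance Definition _ :=
  GRing.isScaleClosed.Build k A in_center in_center_scale.

Fact in_center_submod : GRing.subsemimod_closed in_center.
Proof.
split; last exact: in_center_scale.
exact: GRing.zmod_closedD (GRing.subring_closedB in_center_subring).
Qed.

Record alg_center := Center { center_val : A; _ : center_val \in in_center }.

HB.instance Definition _ := [isSub for center_val].
HB.instance Definition _ := [Choice of alg_center by <:].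
HB.instance Definition _ :=
  GRing.SubChoice_isSubPzRing.Build A in_center alg_center in_center_subring.
HB.instance Definition _ :=
  GRing.SubZmodule_isSubLmodule.Build k A in_center alg_center in_center_submod.

End Center.

Section Tensor.
Variables (k : comPzRingType) (M N : lmodType k).

(** A list [[:: (x1, y1); ...; (xn, yn)]] stands for the formal sum of the
    [xi (x) yi]; [tensor_rel] is the congruence of the monoid of lists generated
    by commutativity and bilinearity. *)
Inductive tensor_rel : seq (M * N) -> seq (M * N) -> Prop :=
| TRefl s : tensor_rel s s
| TSym s t : tensor_rel s t -> tensor_rel t s
| TTrans s t u : tensor_rel s t -> tensor_rel t u -> tensor_rel s u
| TCat s s' t t' : tensor_rel s s' -> tensor_rel t t' ->
    tensor_rel (s ++ t) (s' ++ t')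
| TComm s t : tensor_rel (s ++ t) (t ++ s)
| TZero y : tensor_rel [:: (0, y)] [::]
| TAddl x x' y : tensor_rel [:: (x + x', y)] [:: (x, y); (x', y)]
| TAddr x y y' : tensor_rel [:: (x, y + y')] [:: (x, y); (x, y')]
| TScale a x y : tensor_rel [:: (a *: x, y)] [:: (x, a *: y)].

Definition tensor_relb : rel (seq (M * N)) := fun s t => `[< tensor_rel s t >].

Fact tensor_relb_refl : reflexive tensor_relb.
Proof. by move=> s; apply/asboolP; exact: TRefl. Qed.
Fact tensor_relb_sym : symmetric tensor_relb.
Proof. by move=> s t; apply/asboolP/asboolP; exact: TSym. Qed.
Fact tensor_relb_trans : transitive tensor_relb.
Proof. by move=> t s u /asboolP st /asboolP tu; apply/asboolP; exact: TTrans tu. Qed.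

Canonical tensor_equiv :=
  EquivRel tensor_relb tensor_relb_refl tensor_relb_sym tensor_relb_trans.

Definition tensor : Type := {eq_quot tensor_relb}.
HB.instance Definition _ := Choice.on tensor.
HB.instance Definition _ := EqQuotient.on tensor.

Definition tsum (s : seq (M * N)) : tensor := \pi_tensor s.

Fact tsumP s t : tensor_rel s t <-> tsum s = tsum t.
Proof.
split=> [st|/eqmodP/asboolP //]; by apply/eqmodP/asboolP.
Qed.

Fact tsum_repr (u : tensor) : tsum (repr u) = u.
Proof. exact: reprK. Qed.

Definition tscale (a : k) (s : seq (M * N)) := [seq (a *: p.1, p.2) | p <- s].

Fact tscale_rel a s t : tensor_rel s t -> tensor_rel (tscale a s) (tscale a t).
Proof.
rewrite /tscale; elim=> {s t} /=.
- by move=> s; exact: TRefl.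
- by move=> s t _; exact: TSym.
- by move=> s t u _ st _; exact: TTrans.
- by move=> s s' t t' _ ss _ tt; rewrite !map_cat; exact: TCat.
- by move=> s t; rewrite !map_cat; exact: TComm.
- by move=> y; rewrite scaler0; exact: TZero.
- by move=> x x' y; rewrite scalerDr; exact: TAddl.
- by move=> x y y'; exact: TAddr.
- by move=> b x y; rewrite scalerA mulrC -scalerA; exact: TScale.
Qed.

Definition tensor_zero : tensor := tsum [::].
Definition tensor_add (u v : tensor) : tensor := tsum (repr u ++ repr v).
Definition tensor_scale (a : k) (u : tensor) : tensor := tsum (tscale a (repr u)).
Definition tensor_opp : tensor -> tensor := tensor_scale (- 1).

Fact tensor_addE s t : tensor_add (tsum s) (tsum t) = tsum (s ++ t).
Proof. by apply/tsumP/TCat; apply/tsumP; rewrite tsum_repr. Qed.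
Fact tensor_scaleE a s : tensor_scale a (tsum s) = tsum (tscale a s).
Proof. by apply/tsumP/tscale_rel/tsumP; rewrite tsum_repr. Qed.

Fact tensor_addA : associative tensor_add.
Proof.
move=> u v w; rewrite -(tsum_repr u) -(tsum_repr v) -(tsum_repr w).
by rewrite !tensor_addE catA.
Qed.
Fact tensor_addC : commutative tensor_add.
Proof.
move=> u v; rewrite -(tsum_repr u) -(tsum_repr v) !tensor_addE.
exact/tsumP/TComm.
Qed.
Fact tensor_add0 : left_id tensor_zero tensor_add.
Proof. by move=> u; rewrite -(tsum_repr u) tensor_addE. Qed.

Fact tsum_cons p s : tsum (p :: s) = tensor_add (tsum [:: p]) (tsum s).
Proof. by rewrite tensor_addE. Qed.

Fact tensor_scaleDr : right_distributive tensor_scale tensor_add.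
Proof.
move=> a u v; rewrite -(tsum_repr u) -(tsum_repr v) tensor_addE !tensor_scaleE.
by rewrite tensor_addE /tscale map_cat.
Qed.

Fact tensor_scaleDl u : {morph tensor_scale^~ u : a b / a + b >-> tensor_add a b}.
Proof.
move=> a b; rewrite -(tsum_repr u); elim: (repr u) => [|p s IHs].
  by rewrite !tensor_scaleE /= tensor_addE.
rewrite tsum_cons !tensor_scaleDr IHs !tensor_addA; congr tensor_add.
rewrite -!tensor_addA [in RHS](tensor_addC _ (tensor_scale b _)) !tensor_addA.
congr tensor_add; rewrite !tensor_scaleE tensor_addE /= scalerDl.
exact/tsumP/TAddl.
Qed.

Fact tensor_scale0 u : tensor_scale 0 u = tensor_zero.
Proof.
rewrite -(tsum_repr u); elim: (repr u) => [|p s IHs]; first by rewrite tensor_scaleE.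
rewrite tsum_cons tensor_scaleDr IHs tensor_scaleE /= scale0r tensor_addC.
by rewrite tensor_add0; apply/tsumP/TZero.
Qed.

Fact tensor_scale1 : left_id 1 tensor_scale.
Proof.
move=> u; rewrite -(tsum_repr u) tensor_scaleE /tscale; congr tsum.
by rewrite -[RHS]map_id; apply: eq_map => -[x y]; rewrite scale1r.
Qed.

Fact tensor_scaleA a b u :
  tensor_scale a (tensor_scale b u) = tensor_scale (a * b) u.
Proof.
rewrite -(tsum_repr u) !tensor_scaleE /tscale -map_comp; congr tsum.
by apply: eq_map => -[x y]; rewrite /= scalerA.
Qed.

Fact tensor_addN : left_inverse tensor_zero tensor_opp tensor_add.
Proof.
move=> u; rewrite -[X in tensor_add _ X]tensor_scale1 -tensor_scaleDl addNr.
exact: tensor_scale0.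
Qed.

HB.instance Definition _ := GRing.isZmodule.Build tensor
  tensor_addA tensor_addC tensor_add0 tensor_addN.
HB.instance Definition _ := GRing.Zmodule_isLmodule.Build k tensor
  tensor_scaleA tensor_scale1 tensor_scaleDr tensor_scaleDl.

Definition tens (x : M) (y : N) : tensor := tsum [:: (x, y)].

End Tensor.

Arguments tsum {k M N} s.
Arguments tens {k M N} x y.

Notation "M ⊗[ k ] N" := (@tensor k M N)
  (at level 40, k at level 0, left associativity, format "M  ⊗[ k ]  N") : type_scope.
Notation "x ⊗ y" := (tens x y) (at level 40, left associativity) : ring_scope.

Definition bilinear_map (k : comPzRingType) (M N P : lmodType k)
    (f : M -> N -> P) : Prop :=
  (forall y, linear (f^~ y)) /\ (forall x, linear (f x)).

Section Bilinear.
Variables (k : comPzRingType) (M N P : lmodType k) (f : M -> N -> P).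
Hypothesis f_bilin : bilinear_map f.

Fact bilin0l y : f 0 y = 0.
Proof.
by apply: (addIr (f 0 y)); have := f_bilin.1 y 1 0 0;
   rewrite /= !scale1r addr0 add0r.
Qed.

Fact bilin0r x : f x 0 = 0.
Proof.
by apply: (addIr (f x 0)); have := f_bilin.2 x 1 0 0; rewrite !scale1r addr0 add0r.
Qed.

Fact bilinDl y : {morph f^~ y : x x' / x + x'}.
Proof. by move=> x x'; have := f_bilin.1 y 1 x x'; rewrite /= !scale1r. Qed.

Fact bilinDr x : {morph f x : y y' / y + y'}.
Proof. by move=> y y'; have := f_bilin.2 x 1 y y'; rewrite !scale1r. Qed.

Fact bilinZl a y : {morph f^~ y : x / a *: x}.
Proof. by move=> x; have := f_bilin.1 y a x 0; rewrite /= bilin0l !addr0. Qed.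

Fact bilinZr a x : {morph f x : y / a *: y}.
Proof. by move=> y; have := f_bilin.2 x a y 0; rewrite bilin0r !addr0. Qed.

End Bilinear.

Section TensorTheory.
Variables (k : comPzRingType) (M N : lmodType k).
Implicit Types u v : M ⊗[k] N.

Fact tsum_cat (s t : seq (M * N)) : tsum (s ++ t) = tsum s + tsum t.
Proof. by rewrite [RHS]tensor_addE. Qed.

Fact tsum_nil : tsum [::] = 0 :> M ⊗[k] N. Proof. by []. Qed.

Fact tens_bilinear : bilinear_map (@tens k M N).
Proof.
have ZE a x y : a *: (x ⊗ y : M ⊗[k] N) = (a *: x) ⊗ y.
  by rewrite [LHS]tensor_scaleE.
split=> [y a x x'|x a y y'].
  by rewrite ZE -tsum_cat; apply/tsumP/TAddl.
rewrite ZE; transitivity (x ⊗ (a *: y) + x ⊗ y' : M ⊗[k] N).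
  by rewrite -tsum_cat; apply/tsumP/TAddr.
by congr (_ + _); apply/tsumP/TSym/TScale.
Qed.

Fact tensor_ind (P : M ⊗[k] N -> Prop) :
    P 0 -> (forall u v, P u -> P v -> P (u + v)) -> (forall x y, P (x ⊗ y)) ->
  forall u, P u.
Proof.
move=> P0 PD Pt u; rewrite -(tsum_repr u); elim: (repr u) => [|[x y] s IHs].
  exact: P0.
by rewrite -cat1s tsum_cat; apply: PD IHs; exact: Pt.
Qed.

(** The linear map induced by [f]; meaningful when [f] is bilinear. *)
Definition tlift (P : lmodType k) (f : M -> N -> P) (u : M ⊗[k] N) : P :=
  \sum_(p <- repr u) f p.1 p.2.

Section Lift.
Variables (P : lmodType k) (f : M -> N -> P).
Hypothesis f_bilin : bilinear_map f.

Fact tlift_sum s : tlift f (tsum s) = \sum_(p <- s) f p.1 p.2.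
Proof.
suff rel_sum t t' : tensor_rel t t' ->
    \sum_(p <- t) f p.1 p.2 = \sum_(p <- t') f p.1 p.2.
  by apply: rel_sum; apply/tsumP; rewrite tsum_repr.
elim=> {t t'} //.
- by move=> t u v _ -> _ ->.
- by move=> t u t' u' _ IH1 _ IH2; rewrite !big_cat IH1 IH2.
- by move=> t u; rewrite !big_cat /= addrC.
- by move=> y; rewrite big_seq1 big_nil /= (bilin0l f_bilin).
- by move=> x x' y; rewrite !big_cons !big_nil !addr0 /= (bilinDl f_bilin).
- by move=> x y y'; rewrite !big_cons !big_nil !addr0 /= (bilinDr f_bilin).
- by move=> a x y; rewrite !big_seq1 /= (bilinZl f_bilin) (bilinZr f_bilin).
Qed.

Fact tlift_tens x y : tlift f (x ⊗ y) = f x y.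
Proof. by rewrite tlift_sum big_seq1. Qed.

Fact tlift_linear : linear (tlift f).
Proof.
move=> a u v; rewrite -(tsum_repr u) -(tsum_repr v).
rewrite [a *: _]tensor_scaleE -tsum_cat !tlift_sum big_cat big_map scaler_sumr.
by congr (_ + _); apply: eq_bigr => p _; exact: (bilinZl f_bilin).
Qed.

Fact tlift_unique (g : {linear M ⊗[k] N -> P}) :
  (forall x y, g (x ⊗ y) = f x y) -> g =1 tlift f.
Proof.
move=> gE; apply: tensor_ind => [|u v IHu IHv|x y].
- by rewrite raddf0 -tsum_nil tlift_sum big_nil.
- by have := tlift_linear 1 u v; rewrite !scale1r (raddfD g) /= IHu IHv => ->.
- by rewrite gE tlift_tens.
Qed.

End Lift.
End TensorTheory.

Definition tmap (k : comPzRingType) (M M' N N' : lmodType k)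
    (f : M -> M') (g : N -> N') : M ⊗[k] N -> M' ⊗[k] N' :=
  tlift (fun x y => f x ⊗ g y).

Definition tassoc (k : comPzRingType) (M N P : lmodType k) :
    (M ⊗[k] N) ⊗[k] P -> M ⊗[k] (N ⊗[k] P) :=
  tlift (fun u z => tlift (fun x y => x ⊗ (y ⊗ z)) u).

Fact tmap_tens (k : comPzRingType) (M M' N N' : lmodType k)
    (f : {linear M -> M'}) (g : {linear N -> N'}) x y :
  tmap f g (x ⊗ y) = f x ⊗ g y.
Proof.
have t := @tens_bilinear k M' N'; rewrite /tmap tlift_tens //.
split=> [{}y c u v|{}x c u v].
  by rewrite /= (linearP f) (bilinDl t) (bilinZl t).
by rewrite /= (linearP g) (bilinDr t) (bilinZr t).
Qed.

Fact tassoc_tens (k : comPzRingType) (M N P : lmodType k)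
    (x : M) (y : N) (z : P) : tassoc ((x ⊗ y) ⊗ z) = x ⊗ (y ⊗ z).
Proof.
have t := @tens_bilinear k M (N ⊗[k] P); have t' := @tens_bilinear k N P.
have inner (c : P) : bilinear_map (fun (a : M) (b : N) => a ⊗ (b ⊗ c)).
  split=> [b r u v|a r u v]; first by rewrite /= (bilinDl t) (bilinZl t).
  by rewrite (bilinDl t') (bilinZl t') (bilinDr t) (bilinZr t).
rewrite /tassoc tlift_tens ?tlift_tens //.
split=> [c|u r c d]; first exact: tlift_linear.
rewrite -(tsum_repr u) !tlift_sum // scaler_sumr -big_split.
by apply: eq_bigr => p _; rewrite (bilinDr t') (bilinZr t') (bilinDr t) (bilinZr t).
Qed.

Section TensorAlgebra.
Variables (k : comPzRingType) (A B : pzAlgType k).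
Implicit Types u v w : A ⊗[k] B.

Definition tensor_one : A ⊗[k] B := (1 : A) ⊗ (1 : B).
Definition pure_mul (a : A) (b : B) (a' : A) (b' : B) : A ⊗[k] B :=
  (a * a') ⊗ (b * b').
Definition tensor_mul u v : A ⊗[k] B :=
  tlift (fun (a : A) (b : B) => tlift (pure_mul a b) v) u.

Fact pzalg_mul_bilinear (C : pzAlgType k) : bilinear_map (@GRing.mul C).
Proof.
split=> [y a x x'|x a y y'].
  by rewrite mulrDl pzalg_scalerAl.
by rewrite mulrDr pzalg_scalerAr.
Qed.

Fact tensor_mul_inner a b : bilinear_map (pure_mul a b).
Proof.
have mA := pzalg_mul_bilinear A; have mB := pzalg_mul_bilinear B.
have t := @tens_bilinear k A B.
split=> [y c x x'|x c y y']; rewrite /pure_mul.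
  by rewrite (bilinDr mA) (bilinZr mA) (bilinDl t) (bilinZl t).
by rewrite (bilinDr mB) (bilinZr mB) (bilinDr t) (bilinZr t).
Qed.

Fact tensor_mul_outer v : bilinear_map (fun a b => tlift (pure_mul a b) v).
Proof.
have mA := pzalg_mul_bilinear A; have mB := pzalg_mul_bilinear B.
have t := @tens_bilinear k A B; have ti := tensor_mul_inner.
split=> [y c x x'|x c y y']; rewrite -(tsum_repr v) !tlift_sum //;
  rewrite scaler_sumr -big_split; apply: eq_bigr => p _; rewrite /pure_mul /=.
  by rewrite (bilinDl mA) (bilinZl mA) (bilinDl t) (bilinZl t).
by rewrite (bilinDl mB) (bilinZl mB) (bilinDr t) (bilinZr t).
Qed.

Fact tensor_mul_bilinear : bilinear_map tensor_mul.
Proof.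
split=> [v|u]; first exact: tlift_linear (tensor_mul_outer v).
move=> c v v'; rewrite /tensor_mul -(tsum_repr u).
have to := tensor_mul_outer; have ti := tensor_mul_inner.
rewrite !(tlift_sum (to _)) scaler_sumr -big_split.
by apply: eq_bigr => p _; rewrite (tlift_linear (ti _ _)).
Qed.

Fact tensor_mulE (a a' : A) (b b' : B) :
  tensor_mul (a ⊗ b) (a' ⊗ b') = (a * a') ⊗ (b * b').
Proof.
rewrite [LHS](tlift_tens (tensor_mul_outer _)).
exact: (tlift_tens (tensor_mul_inner _ _)).
Qed.

Fact tensor_mulDl : left_distributive tensor_mul +%R.
Proof. by move=> u v w; rewrite (bilinDl tensor_mul_bilinear). Qed.

Fact tensor_mulDr : right_distributive tensor_mul +%R.
Proof. by move=> u v w; rewrite (bilinDr tensor_mul_bilinear). Qed.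

Fact tensor_mulA : associative tensor_mul.
Proof.
have m := tensor_mul_bilinear.
move=> u v w; elim/tensor_ind: u => [|u u' IHu IHu'|x y].
- by rewrite !(bilin0l m).
- by rewrite !tensor_mulDl IHu IHu'.
elim/tensor_ind: v => [|v v' IHv IHv'|x' y'].
- by rewrite !(bilin0l m) !(bilin0r m) (bilin0l m).
- by rewrite tensor_mulDl !tensor_mulDr tensor_mulDl IHv IHv'.
elim/tensor_ind: w => [|w w' IHw IHw'|x'' y''].
- by rewrite !(bilin0r m).
- by rewrite !tensor_mulDr IHw IHw'.
by rewrite !tensor_mulE !mulrA.
Qed.

Fact tensor_mul1l : left_id tensor_one tensor_mul.
Proof.
have m := tensor_mul_bilinear.
elim/tensor_ind=> [|u v IHu IHv|x y]; first by rewrite (bilin0r m).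
  by rewrite tensor_mulDr IHu IHv.
by rewrite tensor_mulE !mul1r.
Qed.

Fact tensor_mul1r : right_id tensor_one tensor_mul.
Proof.
have m := tensor_mul_bilinear.
elim/tensor_ind=> [|u v IHu IHv|x y]; first by rewrite (bilin0l m).
  by rewrite tensor_mulDl IHu IHv.
by rewrite tensor_mulE !mulr1.
Qed.

HB.instance Definition _ := GRing.Zmodule_isPzRing.Build (A ⊗[k] B)
  tensor_mulA tensor_mul1l tensor_mul1r tensor_mulDl tensor_mulDr.

Fact tensor_scaleAl c u v : c *: (u * v) = c *: u * v.
Proof. by rewrite -(bilinZl tensor_mul_bilinear). Qed.

Fact tensor_scaleAr c u v : c *: (u * v) = u * (c *: v).
Proof. by rewrite -(bilinZr tensor_mul_bilinear). Qed.

HB.instance Definition _ := isPzAlgebra.Build k (A ⊗[k] B)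
  (@scalerA k (A ⊗[k] B)) (@scale1r k (A ⊗[k] B)) (@scalerDr k (A ⊗[k] B))
  (@scalerDl k (A ⊗[k] B)) tensor_scaleAl tensor_scaleAr.

End TensorAlgebra.

Definition is_field (K : comPzRingType) : Prop :=
  1 != 0 :> K /\ forall x : K, x != 0 -> exists y, x * y = 1.

Lemma fieldType_is_field (F : fieldType) : is_field F.
Proof.
by split=> [|x x0]; [exact: oner_neq0 | exists x^-1; rewrite mulfV].
Qed.

Section Situations.
Variables (k : comPzRingType) (A : pzAlgType k).

Definition has_unitary_map : Prop :=
  exists E : {linear A -> alg_center A}, E 1 = 1.

(** An augmentation is a [k]-algebra homomorphism to [k], i.e. a [k]-linear map
    to the regular module [k^o] that is multiplicative and preserves 1. *)
Definition is_augmentation (eps : {linear A -> k^o}) : Prop :=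
  monoid_morphism eps.

Definition is_augmented : Prop := exists eps, is_augmentation eps.

Record bialgebra_structure (D : {linear A -> A ⊗[k] A})
    (eps : {linear A -> k^o}) : Prop := {
  bialg_coassoc : forall a, tassoc (tmap D id (D a)) = tmap id D (D a);
  bialg_counitl : forall a, tlift (fun x y : A => eps x *: y) (D a) = a;
  bialg_counitr : forall a, tlift (fun x y : A => eps y *: x) (D a) = a;
  bialg_comul_morph : monoid_morphism D;
  bialg_counit_morph : monoid_morphism eps
}.

Definition is_bialgebra : Prop := exists D eps, bialgebra_structure D eps.

(** For [e = sum xi (x) yi]: [sum a xi (x) yi = sum xi (x) yi a] for all [a], and
    [sum xi yi = 1]. *)
Definition separability_idempotent (e : A ⊗[k] A) : Prop :=
  (forall a : A,
    tmap (fun x : A => a * x) id e = tmap id (fun y : A => y * a) e) /\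
  tlift (@GRing.mul A) e = 1.

Definition separable_algebra : Prop := exists e, separability_idempotent e.

End Situations.

(* Main.v *)
Require Import Defs.
From HB Require Import structures.
From mathcomp Require Import all_boot all_algebra.
From mathcomp Require Import boolp classical_sets.

(** A unitary map to the center is the same thing as a [k]-linear map [A -> A]
    that fixes [1] and has central values, so each situation is settled by
    exhibiting such a map.

    If [A] is commutative, the identity will do.

    A linear functional [f] on [A] with [f 1 = 1] yields [a |-> f a *: 1], whose
    values are scalars and therefore central.  An augmentation is such a
    functional, and the counit of a bialgebra is an augmentation.  Over a field
    such a functional exists as soon as [1 != 0]: Zorn's lemma gives a subspace
    [W] maximal among those that avoid [1] ([maximal_subspace_avoiding]);
    maximality forces [A = k 1 (+) W], and the functional is the projection onto
    the first summand ([linear_functional_eq1]).  If [1 = 0] then [A] is the zero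
    algebra, which is commutative.

    If [e = sum xi (x) yi] is a separability idempotent, averaging
    [a |-> sum xi a yi] works: applying the bilinear map
    [(x, y) |-> x a y] to the identity [sum b xi (x) yi = sum xi (x) yi b] shows
    that the average commutes with every [b], and its value at [1] is
    [sum xi yi = 1]. *)

Set Implicit Arguments.
Unset Strict Implicit.
Unset Printing Implicit Defensive.

Import GRing.Theory.
Local Open Scope ring_scope.

(** * Linear functionals over a field *)

Section FieldFunctional.
Variables (K : comPzRingType) (V : lmodType K).
Hypothesis K_field : is_field K.
Variable v : V.
Hypothesis v_neq0 : v != 0.

(** [W] may be empty, so that the property passes to the union of any chain,
    including the empty one. *)
Definition avoiding_subspace (W : set V) : Prop :=
  (forall (c : K) x y, W x -> W y -> W (c *: x + y)) /\ ~ W v.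

(** A vector [x] outside a maximal [W] can be added to it only at the price of
    capturing [v], which is why [v] lies in [W + K x].  Since [v] is nonzero, the
    zero subspace avoids it, and so the maximal [W] is not the empty set. *)
Lemma maximal_subspace_avoiding : exists W : set V,
  [/\ avoiding_subspace W, W 0 &
      forall x, ~ W x -> exists c w, W w /\ v = w + c *: x].
Proof.
have [F FP Ftot|W [WP Wmax]] := @Zorn_bigcup V avoiding_subspace.
  split=> [c x y [X FX Xx] [Y FY Yy]|[X FX Xv]]; last exact: (FP _ FX).2.
  have [XY|YX] := Ftot _ _ FX FY.
  - by exists Y => //; apply: (FP _ FY).1 => //; exact: XY.
  - by exists X => //; apply: (FP _ FX).1 => //; exact: YX.
have W0 : W 0.
  apply: contrapT => nW0.
  have Wempty x : ~ W x.
    by move=> Wx; apply: nW0; rewrite -(addNr x) -scaleN1r; exact: WP.1.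
  apply: (Wmax [set 0]%classic); first by split=> [x /Wempty|/(_ 0 erefl)].
  split=> [c x y -> ->|/= v0]; first by rewrite /= scaler0 addr0.
  by move: v_neq0; rewrite v0 eqxx.
exists W; split=> // x nWx; apply: contrapT => no_v.
(* Otherwise W + K x is a strictly larger subspace that still avoids v. *)
pose B : set V := fun y => exists c w, W w /\ y = w + c *: x.
apply: (Wmax B); last first.
  split=> [c _ _ [d [w [Ww ->]]] [d' [w' [Ww' ->]]]|//].
  exists (c * d + d'), (c *: w + w'); split; first exact: WP.1.
  by rewrite scalerDr scalerA scalerDl addrACA.
split=> [w Ww|BW]; first by exists 0, w; rewrite scale0r addr0.
by apply: nWx; apply: BW; exists 1, 0; rewrite scale1r add0r.
Qed.

(** With [W] as above, [V = K v (+) W]: inverting the coefficient of [x] in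
    [v = w + c x] puts [x] in [K v + W], and the sum is direct because [v] is not
    in [W].  The functional is the coordinate along [v]. *)
Lemma linear_functional_eq1 : exists f : {linear V -> K^o}, f v = 1.
Proof.
have [W [[Wlin nWv] W0 Wmax]] := maximal_subspace_avoiding.
have WZ c x : W x -> W (c *: x).
  by move=> Wx; rewrite -[c *: x]addr0; exact: Wlin.
have decomp x : exists c : K, W (x - c *: v).
  have [Wx|/Wmax[c [w [Ww v_eq]]]] := pselect (W x).
    by exists 0; rewrite scale0r subr0.
  have c_neq0 : c != 0.
    by apply/eqP => c0; apply: nWv; rewrite v_eq c0 scale0r addr0.
  have [d cd] := K_field.2 c c_neq0.
  (* v = w + c x, hence x = d v - d w with d the inverse of c. *)
  exists d; rewrite v_eq scalerDr scalerA mulrC cd scale1r opprD addrCA.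
  by rewrite subrr addr0 -scaleNr; exact: WZ.
have uniq_coord x c d : W (x - c *: v) -> W (x - d *: v) -> c = d.
  move=> Wc Wd; apply: contrapT => ncd.
  have [|u cdu] := K_field.2 (d - c); first by rewrite subr_eq0 eq_sym; apply/eqP.
  have Wdc : W ((d - c) *: v).
    have := Wlin (-1) _ _ Wd Wc.
    by rewrite scaleN1r opprB addrA subrK scalerBl.
  by apply: nWv; rewrite -[v]scale1r -cdu mulrC -scalerA; exact: WZ.
have [f fP] := choice decomp.
have f_lin : linear (f : V -> K^o).
  move=> c x y; apply: (uniq_coord (c *: x + y)); first exact: fP.
  have := Wlin c _ _ (fP x) (fP y).
  by rewrite scalerBr addrACA -opprD scalerA -scalerDl.
pose F : {linear V -> K^o} :=
  HB.pack (f : V -> K^o) (GRing.isLinear.Build K V K^o *:%R f f_lin).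
by exists F; apply: (uniq_coord v); rewrite ?scale1r ?subrr //; exact: (fP v).
Qed.

End FieldFunctional.

(** * Bilinear maps on tensors *)

Section TensorMaps.
Variable k : comPzRingType.

Lemma bilinear_map_comp (M M' N N' P : lmodType k) (h : M' -> N' -> P)
    (f : M -> M') (g : N -> N') :
  bilinear_map h -> linear f -> linear g ->
  bilinear_map (fun x y => h (f x) (g y)).
Proof.
move=> [hl hr] f_lin g_lin; split=> [y|x] c u u' /=.
  by rewrite f_lin; exact: hl.
by rewrite g_lin; exact: hr.
Qed.

Lemma tlift_tmap (M M' N N' P : lmodType k) (h : M' -> N' -> P)
    (f : M -> M') (g : N -> N') (u : M ⊗[k] N) :
  bilinear_map h -> linear f -> linear g ->
  tlift h (tmap f g u) = tlift (fun x y => h (f x) (g y)) u.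
Proof.
move=> h_bil f_lin g_lin.
have hfg := bilinear_map_comp h_bil f_lin g_lin.
have tfg := bilinear_map_comp (@tens_bilinear k M' N') f_lin g_lin.
rewrite -(tsum_repr u) tlift_sum // /tmap tlift_sum //.
elim: (repr u) => [|p s IHs].
  by rewrite !big_nil -tsum_nil tlift_sum // big_nil.
rewrite !big_cons -[f p.1 ⊗ g p.2]scale1r tlift_linear // scale1r.
by rewrite tlift_tens // IHs.
Qed.

End TensorMaps.

(** * Unitary maps to the center *)

Section UnitaryMaps.
Variables (k : comPzRingType) (A : pzAlgType k).

(** Stating the target condition on maps [A -> A] avoids manipulating elements of
    the subtype [alg_center A] in each situation. *)
Lemma has_unitary_map_central (f : A -> A) :
  linear f -> (forall a b, f a * b = b * f a) -> f 1 = 1 -> has_unitary_map A.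
Proof.
move=> f_lin f_cent f1.
pose E a : alg_center A := Center (introT (in_centerP (f a)) (f_cent a)).
have E_lin : linear E by move=> c x y; apply: val_inj; rewrite /= f_lin.
pose F : {linear A -> alg_center A} :=
  HB.pack E (GRing.isLinear.Build k A (alg_center A) *:%R E E_lin).
by exists F; exact: val_inj.
Qed.

Lemma has_unitary_map_commutative :
  commutative (@GRing.mul A) -> has_unitary_map A.
Proof. by move=> mulC; apply: (@has_unitary_map_central id). Qed.

Lemma has_unitary_map_functional (f : {linear A -> k^o}) :
  f 1 = 1 -> has_unitary_map A.
Proof.
move=> f1; apply: (@has_unitary_map_central (fun a : A => (f a : k) *: (1 : A))).
- by move=> c x y; rewrite linearP scalerDl -scalerA.
- by move=> a b; rewrite -pzalg_scalerAl -pzalg_scalerAr mul1r mulr1.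
- by rewrite f1 scale1r.
Qed.

Lemma has_unitary_map_field : is_field k -> has_unitary_map A.
Proof.
move=> k_field; have [one0|one_neq0] := eqVneq (1 : A) 0.
  apply: has_unitary_map_commutative => x y.
  by rewrite -[x * y]mulr1 -[y * x]mulr1 one0 !mulr0.
have [f f1] := linear_functional_eq1 k_field one_neq0.
exact: has_unitary_map_functional f1.
Qed.

Lemma has_unitary_map_augmented : is_augmented A -> has_unitary_map A.
Proof. by move=> [eps [eps1 _]]; exact: has_unitary_map_functional eps1. Qed.

Lemma bialgebra_augmented : is_bialgebra A -> is_augmented A.
Proof. by move=> [D [eps [_ _ _ _ eps_morph]]]; exists eps. Qed.

Lemma sandwich_bilinear (a : A) : bilinear_map (fun x y : A => x * a * y).
Proof.
split=> [y c x x'|x c y y'] /=.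
  by rewrite !mulrDl -!pzalg_scalerAl.
by rewrite mulrDr pzalg_scalerAr.
Qed.

(** The map averages [a] over the idempotent [e].  The identity [b e = e b] holds
    only in the tensor product, not between representing sums; bilinearity of
    [(x, y) |-> x a y] is what transports it to [A]. *)
Lemma has_unitary_map_separable : separable_algebra A -> has_unitary_map A.
Proof.
move=> [e [e_comm e_one]].
apply: (@has_unitary_map_central
  (fun a : A => tlift (fun x y : A => x * a * y) e)).
- move=> c a b; rewrite /tlift scaler_sumr -big_split; apply: eq_bigr => p _.
  by rewrite mulrDr mulrDl -pzalg_scalerAr -pzalg_scalerAl.
- move=> a b.
  have lmul_lin : linear (fun x : A => b * x).
    by move=> c x y; rewrite mulrDr pzalg_scalerAr.
  have rmul_lin : linear (fun x : A => x * b).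
    by move=> c x y; rewrite mulrDl pzalg_scalerAl.
  have id_lin : linear (@id A) by [].
  have := congr1 (tlift (fun x y : A => x * a * y)) (e_comm b).
  have ha := sandwich_bilinear a.
  rewrite !tlift_tmap // /tlift mulr_suml mulr_sumr => e_ab.
  under eq_bigr do rewrite -mulrA.
  by rewrite -e_ab; apply: eq_bigr => p _; rewrite !mulrA.
- by rewrite -[RHS]e_one; apply: eq_bigr => p _; rewrite mulr1.
Qed.

End UnitaryMaps.

Theorem proposition2p7 (k : comPzRingType) (A : pzAlgType k) :
  (commutative (@GRing.mul A) -> has_unitary_map A) /\
  (is_field k -> has_unitary_map A) /\
  ((is_augmented A -> has_unitary_map A) /\
   (is_bialgebra A -> is_augmented A /\ has_unitary_map A)) /\
  (separable_algebra A -> has_unitary_map A).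
Proof.
split; first exact: has_unitary_map_commutative.
split; first exact: has_unitary_map_field.
split; last exact: has_unitary_map_separable.
split=> [|/bialgebra_augmented A_aug]; first exact: has_unitary_map_augmented.
by split=> //; exact: has_unitary_map_augmented.
Qed.
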